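(* Let $\lambda$ be the Liouville function. Then the power series $\sum_{n=1}^\infty \lambda(n)z^n\in \mathbb{Z}[[z]]$ is transcendental over $\mathbb{Z}[z]$.
   Context: The Liouville function $\lambda:\{1,2,3,\dots\}\to\{-1,1\}$ is the unique completely multiplicative function (i.e. $\lambda(mn)=\lambda(m)\lambda(n)$ for all positive integers $m,n$, and $\lambda(1)=1$) with $\lambda(p)=-1$ for all primes $p$. A power series $F(z)\in\mathbb{Z}[[z]]$ is transcendental over $\mathbb{Z}[z]$ if there is no nonzero polynomial $P(y)=a_d(z)y^d+\cdots+a_1(z)y+a_0(z)$ with coefficients $a_i(z)\in\mathbb{Z}[z]$ such that $P(F(z))=0$ in $\mathbb{Z}[[z]]$. *)

(* Defs.v *)
From HB Require Import structures.
From mathcomp Require Import all_boot all_order all_algebra.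
From mathcomp Require Import boolp.

Set Implicit Arguments.
Unset Strict Implicit.
Unset Printing Implicit Defensive.

Import Order.TTheory GRing.Theory Num.Theory.
Local Open Scope ring_scope.

(* A power series is its coefficient sequence; boolp supplies extensionality and
   the choiceType structure that the algebraic hierarchy requires. *)
Record fps (R : comNzRingType) : Type := Fps { fps_coef : nat -> R }.

Section FpsRing.
Variable R : comNzRingType.
Implicit Types f g h : fps R.

Lemma fpsP f g : fps_coef f =1 fps_coef g <-> f = g.
Proof. by split=> [|-> //]; case: f g => [f] [g] /= /funext ->. Qed.

HB.instance Definition _ := gen_eqMixin (fps R).
HB.instance Definition _ := gen_choiceMixin (fps R).

Definition fps_zero : fps R := Fps (fun=> 0).
Definition fps_opp f : fps R := Fps (fun n => - fps_coef f n).
Definition fps_add f g : fps R := Fps (fun n => fps_coef f n + fps_coef g n).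

Fact fps_addA : associative fps_add.
Proof. by move=> f g h; apply/fpsP => n /=; rewrite addrA. Qed.
Fact fps_addC : commutative fps_add.
Proof. by move=> f g; apply/fpsP => n /=; rewrite addrC. Qed.
Fact fps_add0 : left_id fps_zero fps_add.
Proof. by move=> f; apply/fpsP => n /=; rewrite add0r. Qed.
Fact fps_addN : left_inverse fps_zero fps_opp fps_add.
Proof. by move=> f; apply/fpsP => n /=; rewrite addNr. Qed.

HB.instance Definition _ :=
  GRing.isZmodule.Build (fps R) fps_addA fps_addC fps_add0 fps_addN.

Definition fps_one : fps R := Fps (fun n => (n == 0%N)%:R).
Definition fps_mul f g : fps R :=
  Fps (fun n => \sum_(i < n.+1) fps_coef f i * fps_coef g (n - i)).

Definition fps_trunc (n : nat) f : {poly R} := \poly_(i < n.+1) fps_coef f i.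

Lemma coef_fps_trunc n f i : (i <= n)%N -> (fps_trunc n f)`_i = fps_coef f i.
Proof. by move=> le_in; rewrite coef_poly ltnS le_in. Qed.

Lemma coef_fps_mul_trunc n f g i : (i <= n)%N ->
  fps_coef (fps_mul f g) i = (fps_trunc n f * fps_trunc n g)`_i.
Proof.
move=> le_in; rewrite coefM /=; apply: eq_bigr => j _.
rewrite !coef_fps_trunc //; first exact: leq_trans (leq_subr _ _) le_in.
by apply: leq_trans le_in; rewrite -ltnS.
Qed.

Fact fps_mulC : commutative fps_mul.
Proof.
by move=> f g; apply/fpsP => n; rewrite !(@coef_fps_mul_trunc n) // mulrC.
Qed.

Fact fps_mulA : associative fps_mul.
Proof.
move=> f g h; apply/fpsP => n.
have -> : fps_coef (fps_mul f (fps_mul g h)) n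
          = (fps_trunc n f * (fps_trunc n g * fps_trunc n h))`_n.
  rewrite coefM /=; apply: eq_bigr => j _.
  rewrite coef_fps_trunc -1?ltnS //; congr (_ * _).
  exact: (coef_fps_mul_trunc g h (leq_subr j n)).
rewrite mulrA coefM /=; apply: eq_bigr => j _.
rewrite (coef_fps_trunc h (leq_subr j n)); congr (_ * _).
by rewrite -(@coef_fps_mul_trunc n) // -ltnS.
Qed.

Fact fps_mul1 : left_id fps_one fps_mul.
Proof.
move=> f; apply/fpsP => n /=.
by rewrite big_ord_recl /= mul1r subn0 big1 ?addr0 // => i _; rewrite mul0r.
Qed.

Fact fps_mulDl : left_distributive fps_mul fps_add.
Proof.
move=> f g h; apply/fpsP => n /=.
by rewrite -big_split /=; apply: eq_bigr => i _; rewrite mulrDl.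
Qed.

Fact fps_one_neq0 : fps_one != 0 :> fps R.
Proof.
by apply/eqP => /fpsP /(_ 0%N) /= /eqP; rewrite oner_eq0.
Qed.

HB.instance Definition _ := GRing.Zmodule_isComNzRing.Build (fps R)
  fps_mulA fps_mulC fps_mul1 fps_mulDl fps_one_neq0.

Definition fps_of_poly (p : {poly R}) : fps R := Fps (fun n => p`_n).

Fact fps_of_poly_is_zmod_morphism : zmod_morphism fps_of_poly.
Proof. by move=> p q; apply/fpsP => n /=; rewrite coefB. Qed.

Fact fps_of_poly_is_monoid_morphism : monoid_morphism fps_of_poly.
Proof.
split=> [|p q]; apply/fpsP => n /=; first by rewrite coef1.
by rewrite coefM.
Qed.

HB.instance Definition _ := GRing.isZmodMorphism.Build {poly R} (fps R)
  fps_of_poly fps_of_poly_is_zmod_morphism.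
HB.instance Definition _ := GRing.isMonoidMorphism.Build {poly R} (fps R)
  fps_of_poly fps_of_poly_is_monoid_morphism.

Lemma fps_of_poly_inj : injective fps_of_poly.
Proof. by move=> p q /fpsP eq_pq; apply/polyP. Qed.

(* [P] is a polynomial in y whose coefficients are polynomials in z. *)
Definition fps_transcendental f : Prop :=
  ~ exists2 P : {poly {poly R}}, P != 0 & (map_poly fps_of_poly P).[f] = 0.

End FpsRing.

(* The Liouville function is defined on positive integers only: lambda 0 is
   unconstrained. *)
Definition is_liouville (lambda : nat -> int) : Prop :=
  [/\ forall n, (0 < n)%N -> lambda n = 1 \/ lambda n = -1,
      lambda 1%N = 1,
      forall m n, (0 < m)%N -> (0 < n)%N ->
        lambda (m * n)%N = lambda m * lambda n
    & forall p, prime p -> lambda p = -1].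

Lemma is_liouville_ex : exists lambda, is_liouville lambda.
Proof.
pose Om n := (\sum_(p <- primes n) logn p n)%N.
have OmE N n : (0 < n)%N -> (n <= N)%N ->
    Om n = (\sum_(0 <= p < N.+1) logn p n)%N.
  move=> n_gt0 le_nN; rewrite [RHS](bigID (mem (primes n))) /=.
  rewrite [X in (_ + X)%N]big1 ?addn0; last first.
    by move=> p; rewrite -logn_gt0 -eqn0Ngt => /eqP.
  rewrite -big_filter; apply: perm_big; apply: uniq_perm.
  - exact: primes_uniq.
  - exact/filter_uniq/iota_uniq.
  move=> p; rewrite mem_filter mem_index_iota /= andbC.
  case pn: (p \in primes n); rewrite ?andbF // andbT ltnS.
  move: pn; rewrite mem_primes => /and3P[_ _ /(dvdn_leq n_gt0) le_pn].
  by rewrite (leq_trans le_pn).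
exists (fun n => (-1) ^+ Om n); split=> [n _||m n m_gt0 n_gt0|p p_pr].
- by rewrite -signr_odd; case: (odd _); [right|left].
- by rewrite /Om big_nil.
- rewrite -exprD; congr (_ ^+ _).
  have mn_gt0 : (0 < m * n)%N by rewrite muln_gt0 m_gt0.
  rewrite (OmE (m * n)%N m) ?leq_pmulr // (OmE (m * n)%N n) ?leq_pmull //.
  rewrite (OmE (m * n)%N) // -big_split /=; apply: eq_bigr => p _.
  exact: lognM.
- by rewrite /Om primes_prime // big_seq1 logn_prime // eqxx.
Qed.

Lemma is_liouville_unique lambda mu : is_liouville lambda -> is_liouville mu ->
  forall n, (0 < n)%N -> lambda n = mu n.
Proof.
move=> [_ l1 lM lp] [_ m1 mM mp] n.
have [N] := ubnP n; elim: N n => // N IH n lt_nN n_gt0.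
have [n_le1|n_gt1] := leqP n 1; first
  by rewrite (_ : n = 1%N) ?l1 ?m1 //; apply/eqP; rewrite eqn_leq n_le1.
have p_pr := pdiv_prime n_gt1; have p_gt0 := prime_gt0 p_pr.
have q_gt0 : (0 < n %/ pdiv n)%N by rewrite divn_gt0 // pdiv_leq.
rewrite -(divnK (pdiv_dvd n)) lM // mM // (lp _ p_pr) (mp _ p_pr) IH //.
by apply: leq_trans (ltn_Pdiv (prime_gt1 p_pr) n_gt0) _; rewrite -ltnS.
Qed.

(* The series \sum_(n >= 1) a n z^n; a 0 is ignored. *)
Definition fps_from1 (a : nat -> int) : fps int :=
  Fps (fun n => if (0 < n)%N then a n else 0).

(* Main.v *)
From HB Require Import structures.
Require Import Defs.
From mathcomp Require Import all_boot all_order all_algebra.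
From mathcomp Require Import finfield boolp zify ring.

(** The series is reduced modulo 3, where the values 1 and -1 of the Liouville
    function stay distinct.  An algebraic relation over Z[z] survives the
    reduction once it has been divided by the largest possible power of 3
    ([primitive_annihilator]), so it suffices to exclude that the reduced
    sequence L is algebraic over F_3(z).

    By the easy half of Christol's theorem ([algebraic_automatic]), an algebraic
    series f over F_p is p-automatic: its iterated sections n |-> f_(p^j n + r)
    form a finite set.  Reducing the powers f^(p^i) modulo the annihilating
    polynomial gives a linear relation between them; Cartier operators turn it
    into one in which f itself has a nonzero coefficient; and the series that are
    combinations of the (f / c_0)^(p^i) with coefficients of bounded degree then
    form a finite set stable under the Cartier operators.

    It remains to see that a completely multiplicative p-automatic L without
    zeros on positive integers equals 1 on a progression 1 + p^k N
    ([automatic_multiplicative]).  Some power q of p is such that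
    n |-> L(q^j n + r) is the same sequence for all large j; let kappa r denote
    that sequence.  It takes finitely many values.  Since L is multiplicative,
    kappa (t r) determines kappa r, and finiteness gives the converse: having
    the same kappa is a multiplicative congruence on the positive integers, whose
    quotient is a finite abelian group G.  Writing y to the left of x in base q (well
    separated) induces on G an associative operation, over which multiplication
    distributes.  A finite semigroup has an idempotent, and multiplication by G
    permutes the elements transitively, so all elements are idempotent; similarly
    no element lies strictly below another, whence x y x = x for the operation:
    the semigroup is a rectangular band.  Therefore 1 juxtaposed with n depends
    only on the leading digits of n.  As it is also compatible with scaling n,
    and any two consecutive large integers have a common multiplier that puts
    both just above a power of q, it does not depend on n at all
    ([juxt1_const]); so L(1 + q^2 n) = 1.

    For p = 3 this is absurd: 7^(3^k) is congruent to 1 modulo 3^k, while the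
    Liouville function takes the value -1 at an odd power of the prime 7. *)

Set Implicit Arguments.
Unset Strict Implicit.
Unset Printing Implicit Defensive.

Import Order.TTheory GRing.Theory Num.Theory.

(** * Automatic sequences and their tails *)

(** A sequence in a finite set in which each value determines the next is
    eventually periodic, and any large multiple d of the period works.  This
    yields idempotents in all the finite semigroups met below. *)
Lemma finite_dynamics_idempotent (C : finType) (g : nat -> C) :
  (forall n m, g n = g m -> g n.+1 = g m.+1) ->
  exists2 d, 0 < d & g (d + d) = g d.
Proof.
move=> gS.
have [i [k [lt_ik gik]]] : exists i k, i < k /\ g i = g k.
  have /injectivePn[x [y xy gxy]] : ~~ injectiveb (fun i : 'I_#|C|.+1 => g i).
    by apply/injectiveP => /leq_card; rewrite card_ord ltnn.
  by case: (ltngtP x y) => [lt|lt|/val_inj e]; [exists x, y|exists y, x|rewrite e eqxx in xy].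
have gD s a : i <= a -> g (a + s * (k - i)) = g a.
  have gA n : g (i + n) = g (k + n).
    by elim: n => [|n IH]; rewrite ?addn0 // !addnS; apply: gS.
  move=> le_ia; elim: s => [|s <-]; first by rewrite addn0.
  rewrite (_ : a + s.+1 * _ = k + (a - i + s * (k - i))); last by lia.
  rewrite -gA; congr g; lia.
exists (k * (k - i)); first by nia.
apply: gD; nia.
Qed.

(** The finite set S indexes a set of sequences that contains a and is closed
    under n |-> p n + r; this is finiteness of the p-kernel. *)
Definition automatic (A : Type) p (a : nat -> A) : Prop :=
  exists (S : finType) (out : S -> nat -> A),
    (exists s, out s =1 a) /\
    (forall s r, r < p -> exists s', forall n, out s' n = out s (p * n + r)).

(** A state is reached by reading the p digits of r from the lowest one; reading
    further zeros applies a fixed self-map of S, one of whose iterates, the d-th,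
    is idempotent.  Hence, with digits in base q = p ^ d, one extra leading zero
    (the exponent j.+1 where r < q ^ j) makes the state independent of j. *)
Lemma automatic_tails (A : Type) p (a : nat -> A) : 1 < p -> automatic p a ->
  exists d (S : finType) (sigma : nat -> S), let q := p ^ d in
  [/\ 0 < d,
      forall r j j' n, r < q ^ j -> r < q ^ j' ->
        a (q ^ j.+1 * n + r) = a (q ^ j'.+1 * n + r)
    & forall r r', sigma r = sigma r' ->
        forall n, a (q ^ r.+1 * n + r) = a (q ^ r'.+1 * n + r')].
Proof.
move=> p_gt1 [S [out [[s0 out0] ker]]]; have p_gt0 := ltnW p_gt1.
have [step stepE] : {step : S -> nat -> S |
    forall s r, r < p -> forall n, out (step s r) n = out s (p * n + r)}.
  apply: cid.
  have /choice[f fP] : forall sr : S * nat, exists s', sr.2 < p ->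
      forall n, out s' n = out sr.1 (p * n + sr.2).
    move=> [s r] /=; have [/(ker s)[s' s'E]|_] := ltnP r p; last by exists s.
    by exists s'.
  by exists (fun s r => f (s, r)) => s r /(fP (s, r)).
pose read j r := iteri j (fun i s => step s (r %/ p ^ i %% p)) s0.
have readE j r n : out (read j r) n = a (p ^ j * n + r %% p ^ j).
  elim: j n => [|j IH] n /=; first by rewrite out0 mul1n modn1 addn0.
  rewrite stepE ?ltn_mod // IH expnS; congr a.
  rewrite mulnDr mulnA [_ * p]mulnC -addnA; congr addn.
  by rewrite modn_divl [in RHS](divn_eq (r %% (p * p ^ j)) (p ^ j)) mulnC modn_dvdm ?dvdn_mull.
(* The idempotent iterate is taken in the finite set of self-maps of S. *)
pose zero s := step s 0.
have [|d d_gt0 zd] := @finite_dynamics_idempotent _ (fun n => [ffun s => iter n zero s]).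
  move=> n m /ffunP e; apply/ffunP => s.
  by rewrite !ffunE /=; have := e s; rewrite !ffunE => ->.
have zdd s : iter d zero (iter d zero s) = iter d zero s.
  by have /ffunP/(_ s) := zd; rewrite !ffunE iterD.
have readD j i r : r < p ^ j -> read (i + j) r = iter i zero (read j r).
  move=> rj; elim: i => [|i IH] //=; rewrite IH divn_small ?mod0n //.
  by apply: leq_trans rj _; rewrite leq_exp2l // leq_addl.
have q_gt1 : 1 < p ^ d by rewrite -(exp1n d) ltn_exp2r.
have readq j r : r < (p ^ d) ^ j -> read (d * j.+1) r = read (d * r.+1) r.
  have room i : r < (p ^ d) ^ i -> read (d * i.+2) r = read (d * i.+1) r.
    by rewrite -expnM => ri; rewrite !mulnS addnA readD // readD // iterD zdd.
  have all i k : r < (p ^ d) ^ i -> read (d * (i + k).+1) r = read (d * i.+1) r.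
    move=> ri; elim: k => [|k <-]; first by rewrite addn0.
    rewrite addnS room //; apply: leq_trans ri _.
    by rewrite leq_exp2l // leq_addr.
  by move=> rj; rewrite -(all j r) // addnC all // ltn_expl.
exists d, S, (fun r => read (d * r.+1) r) => q; split=> //.
  move=> r j j' n rj rj'.
  have E i : r < q ^ i -> a (q ^ i.+1 * n + r) = out (read (d * r.+1) r) n.
    move=> ri; rewrite -(readq _ _ ri) readE /q -!expnM modn_small // expnM.
    by apply: leq_trans ri _; rewrite leq_exp2l.
  by rewrite !E.
have E r n : a (q ^ r.+1 * n + r) = out (read (d * r.+1) r) n.
  by rewrite readE -expnM modn_small // expnM ltnW // ltn_expl.
by move=> r r' e n; rewrite !E e.
Qed.

(** * Multiplicative congruences with finitely many classes *)

(** The hypotheses isolate what is used of the map sending r to the common value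
    of the sequences n |-> L (q ^ j.+1 * n + r), r < q ^ j, when L is completely
    multiplicative and automatic. *)

Section Congruence.

Variables (q : nat) (C : finType) (kappa : nat -> C).
Hypothesis q_gt1 : 1 < q.
Hypothesis kappa0 : forall r, kappa r = kappa 0 -> r = 0.
Hypothesis kappa_cancel : forall t r r', 0 < t ->
  kappa (t * r) = kappa (t * r') -> kappa r = kappa r'.
Hypothesis kappa_digits : forall r r' j j' n, kappa r = kappa r' ->
  r < q ^ j -> r' < q ^ j' ->
  kappa (r + q ^ j.+1 * n) = kappa (r' + q ^ j'.+1 * n).

Let q_gt0 : 0 < q := ltnW q_gt1.

(** The class of t * r determines that of r, so the classes of multiples of t map
    onto all classes; as they are themselves among the finitely many classes, the
    map is a bijection, and the class of r determines that of t * r. *)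
Lemma kappa_scale t r r' :
  kappa r = kappa r' -> kappa (t * r) = kappa (t * r').
Proof.
case: t => [|t]; first by rewrite !mul0n.
move: (ltn0Sn t); move: t.+1 => {}t t_gt0.
pose A := [set X | `[< exists r, kappa r = X >]].
pose B := [set X | `[< exists r, kappa (t * r) = X >]].
have [rep repP] : {rep : C -> nat | forall X, X \in B -> kappa (t * rep X) = X}.
  apply: cid; have /choice[rep repP] : forall X, exists r, X \in B -> kappa (t * r) = X.
    move=> X; case: (boolP (X \in B)) => [|_]; last by exists 0.
    by rewrite inE => /asboolP[s sX]; exists s.
  by exists rep.
pose psi X := kappa (rep X).
have inB s : kappa (t * s) \in B by rewrite inE; apply/asboolP; exists s.
have psiE s : psi (kappa (t * s)) = kappa s.
  by apply: kappa_cancel t_gt0 _; rewrite repP.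
(* psi maps B onto A, and B is contained in A. *)
have psi_inj : {in B &, injective psi}.
  apply/imset_injP; rewrite eqn_leq leq_imset_card /=.
  apply: (@leq_trans #|A|); apply: subset_leq_card; apply/subsetP => X.
    by rewrite !inE => /asboolP[s <-]; apply/asboolP; exists (t * s).
  by rewrite inE => /asboolP[s <-]; rewrite -psiE; apply: imset_f.
by move=> e; apply: psi_inj; rewrite ?psiE.
Qed.

Lemma kappaM x x' y y' :
  kappa x = kappa x' -> kappa y = kappa y' -> kappa (x * y) = kappa (x' * y').
Proof.
by move=> ex ey; rewrite (kappa_scale x ey) mulnC (kappa_scale y' ex) mulnC.
Qed.

(** With [kappaM] and [kappa_cancel], classes of positive integers form a finite
    cancellative monoid, hence a group. *)
Lemma kappa_torsion u : 0 < u -> exists2 e, 0 < e & kappa (u ^ e) = kappa 1.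
Proof.
move=> u_gt0.
have [|d d_gt0 e] := @finite_dynamics_idempotent _ (fun n => kappa (u ^ n)).
  by move=> n m; rewrite !expnS; apply: kappa_scale.
exists d => //; apply: (@kappa_cancel (u ^ d)); rewrite ?expn_gt0 ?u_gt0 //.
by rewrite muln1 -expnD.
Qed.

Lemma kappa_inverse u : 0 < u -> exists2 v, 0 < v & kappa (u * v) = kappa 1.
Proof.
move=> u_gt0; have [[//|e] _ eu] := kappa_torsion u_gt0.
by exists (u ^ e); rewrite ?expn_gt0 ?u_gt0 // -expnS.
Qed.

(** In base q, the digits of y written to the left of those of x, with a gap wide
    enough for [kappa_digits]. *)
Definition juxt x y := x + q ^ x.+1 * y.

Let juxt_room x : x < q ^ x := ltn_expl x q_gt1.

Lemma juxtE x y j : x < q ^ j -> kappa (x + q ^ j.+1 * y) = kappa (juxt x y).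
Proof. by move=> xj; apply: kappa_digits => //; apply: juxt_room. Qed.

(** Multiplication by t distributes over juxtaposition as soon as the gap is wide
    enough for t * x too, and the width of the gap does not matter. *)
Lemma juxt_scale t x y : kappa (t * juxt x y) = kappa (juxt (t * x) (t * y)).
Proof.
case: (posnP t) => [->|t_gt0]; first by rewrite !mul0n /juxt muln0.
have room : x < q ^ (t * x).
  by apply: leq_trans (juxt_room x) _; rewrite leq_exp2l // leq_pmull.
rewrite -(kappa_scale t (juxtE y room)).
by rewrite mulnDr mulnCA juxtE // juxt_room.
Qed.

(** The numbers y * juxt 1 y' and y' * juxt 1 y have the same upper part y * y'
    and equivalent lower parts y and y', so they are equivalent; y and y' then
    cancel. *)
Lemma kappa_juxt1 y y' : 0 < y -> 0 < y' -> kappa y = kappa y' ->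
  kappa (juxt 1 y) = kappa (juxt 1 y').
Proof.
move=> y_gt0 y'_gt0 e; apply: (@kappa_cancel y) => //.
rewrite (juxt_scale y 1 y') [RHS](_ : _ = kappa (juxt y' (y * y'))); last first.
  by apply: kappa_digits; rewrite ?muln1 // juxt_room.
have -> : kappa (y * juxt 1 y) = kappa (y' * juxt 1 y).
  by rewrite ![_ * juxt 1 y]mulnC; apply: kappa_scale.
by rewrite juxt_scale muln1 [y' * y]mulnC.
Qed.

(** Dependence on the lower part is [kappa_digits].  For the upper part, multiply
    by an inverse of the lower one to reduce to [kappa_juxt1]. *)
Lemma kappa_juxt x x' y y' : kappa x = kappa x' -> kappa y = kappa y' ->
  kappa (juxt x y) = kappa (juxt x' y').
Proof.
move=> ex ey.
transitivity (kappa (juxt x' y)); first by apply: kappa_digits => //; apply: juxt_room.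
have [x0|x_gt0] := posnP x'.
  by rewrite x0 /juxt !add0n; apply: kappa_scale.
have [y0|y_gt0] := posnP y.
  by have := esym ey; rewrite y0 => /kappa0 ->.
have y'_gt0 : 0 < y'.
  by case: (posnP y') => // y0; move: ey y_gt0; rewrite y0 => /kappa0 ->.
have [v v_gt0 ev] := kappa_inverse x_gt0.
have norm z : kappa (v * juxt x' z) = kappa (juxt 1 (v * z)).
  by rewrite juxt_scale; apply: kappa_digits; rewrite ?juxt_room // mulnC.
apply: (kappa_cancel v_gt0); rewrite !norm.
apply: kappa_juxt1; rewrite ?muln_gt0 ?v_gt0 ?y_gt0 ?y'_gt0 //.
exact: kappa_scale.
Qed.

Lemma juxtA x y z : kappa (juxt (juxt x y) z) = kappa (juxt x (juxt y z)).
Proof.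
rewrite -(@juxtE _ _ (x.+1 + y)).
  by rewrite -addnS expnD /juxt mulnDr addnA mulnA.
rewrite expnD; apply: (@leq_trans (q ^ x.+1 * y.+1)).
  rewrite mulnS /juxt ltn_add2r; apply: leq_trans (juxt_room x) _.
  by rewrite leq_exp2l.
by rewrite leq_pmul2l ?expn_gt0 ?q_gt0 // juxt_room.
Qed.

Fixpoint repunit n : nat := if n is m.+1 then juxt 1 (repunit m) else 0.

Lemma kappa_repunitD m n :
  kappa (juxt (repunit m.+1) (repunit n)) = kappa (repunit (m.+1 + n)).
Proof.
elim: m => [|m IH]; first by rewrite (_ : repunit 1 = 1) //= /juxt muln0.
by rewrite [repunit m.+2]/= juxtA; apply: kappa_juxt.
Qed.

(** The multiples of 1 for juxtaposition contain an idempotent g; dividing the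
    relation juxt g g = g by g gives the claim. *)
Lemma juxt11 : kappa (juxt 1 1) = kappa 1.
Proof.
have [|[//|d] _ e] := @finite_dynamics_idempotent _ (fun n => kappa (repunit n)).
  by move=> n m e; apply: kappa_juxt.
apply: (@kappa_cancel (repunit d.+1)); first by rewrite /= /juxt.
by rewrite juxt_scale muln1 kappa_repunitD.
Qed.

(** The order of idempotents is transitive along the powers of f. *)
Lemma juxt1_pow f k : kappa (juxt 1 f) = kappa f ->
  kappa (juxt 1 (f ^ k.+1)) = kappa (f ^ k.+1).
Proof.
move=> e1f; elim: k => [|k IH]; first by rewrite expn1.
have e : kappa (juxt f (f ^ k.+2)) = kappa (f ^ k.+2).
  rewrite -[X in juxt X]muln1 expnS -juxt_scale; exact: kappa_scale.
rewrite -(kappa_juxt (erefl (kappa 1)) e) -juxtA -e.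
exact: kappa_juxt.
Qed.

(** The element f = juxt 1 (juxt y 1) lies below 1 in the order of idempotents.
    Multiplication preserves that order, so 1 is above f, which is above f ^ 2,
    and so on; since a power of f is equivalent to 1, the chain collapses. *)
Lemma juxt_sandwich1 y : kappa (juxt 1 (juxt y 1)) = kappa 1.
Proof.
set f := juxt 1 (juxt y 1).
have f_gt0 : 0 < f by rewrite /f /juxt.
have e1f : kappa (juxt 1 f) = kappa f.
  by rewrite -juxtA; apply: kappa_juxt => //; apply: juxt11.
have ef1 : kappa (juxt f 1) = kappa f.
  rewrite juxtA; apply: kappa_juxt => //.
  by rewrite juxtA; apply: kappa_juxt => //; apply: juxt11.
have [e e_gt0 fe] := kappa_torsion f_gt0.
have fee : kappa (f ^ (e + e)) = kappa 1.
  by rewrite expnD (kappaM fe fe).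
(* Doubling e leaves a positive exponent once one factor f is split off. *)
case: e e_gt0 fee {fe} => // e _; rewrite addnS => fee.
rewrite -[RHS]fee -ef1 -(kappa_juxt (erefl (kappa f)) fee).
rewrite addSn expnS -{1}[f]muln1 -juxt_scale; apply: kappa_scale.
exact: juxt1_pow.
Qed.

Lemma juxt_sandwich x y : 0 < x -> kappa (juxt x (juxt y x)) = kappa x.
Proof.
move=> x_gt0; have [v v_gt0 e] := kappa_inverse x_gt0.
apply: (kappa_cancel v_gt0); rewrite [v * x]mulnC e juxt_scale.
rewrite -[RHS](juxt_sandwich1 (v * y)); apply: kappa_juxt; first by rewrite mulnC.
by rewrite juxt_scale; apply: kappa_juxt => //; rewrite mulnC.
Qed.

(** The law x y z = x z of rectangular bands, here for x = 1. *)
Lemma juxt1_absorb x y : 0 < y ->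
  kappa (juxt 1 (juxt x y)) = kappa (juxt 1 y).
Proof.
move=> y_gt0.
rewrite -[RHS](kappa_juxt (juxt_sandwich1 (juxt x y)) (erefl (kappa y))).
rewrite [RHS]juxtA; apply: kappa_juxt => //; rewrite ![RHS]juxtA.
by apply: kappa_juxt; rewrite // juxt_sandwich.
Qed.

(** By [juxt1_absorb], t * juxt 1 z = juxt t (t * z) may replace t * z above
    a digit 1. *)
Lemma juxt1_scale t x y : 0 < t -> 0 < x -> 0 < y ->
  kappa (juxt 1 x) = kappa (juxt 1 y) ->
  kappa (juxt 1 (t * x)) = kappa (juxt 1 (t * y)).
Proof.
move=> t_gt0 x_gt0 y_gt0 e.
have tx z : 0 < z -> kappa (juxt 1 (t * juxt 1 z)) = kappa (juxt 1 (t * z)).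
  move=> z_gt0; rewrite -[RHS](@juxt1_absorb t) ?muln_gt0 ?t_gt0 //.
  by apply: kappa_juxt => //; rewrite juxt_scale muln1.
rewrite -(tx x) // -(tx y) //.
by apply: kappa_juxt => //; apply: kappa_scale.
Qed.

Lemma juxt1_cancel t x y : 0 < t -> 0 < x -> 0 < y ->
  kappa (juxt 1 (t * x)) = kappa (juxt 1 (t * y)) ->
  kappa (juxt 1 x) = kappa (juxt 1 y).
Proof.
move=> t_gt0 x_gt0 y_gt0 e; have [v v_gt0 ev] := kappa_inverse t_gt0.
have vt z : kappa (juxt 1 (v * (t * z))) = kappa (juxt 1 z).
  apply: kappa_juxt => //; rewrite mulnA -[in RHS](mul1n z); apply: kappaM => //.
  by rewrite mulnC.
by rewrite -(vt x) -(vt y); apply: juxt1_scale; rewrite // muln_gt0 t_gt0.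
Qed.

(** The digits of r are absorbed, which leaves juxt 1 1. *)
Lemma juxt1_leading1 j r : 0 < r -> r < q ^ j ->
  kappa (juxt 1 (q ^ j.+1 + r)) = kappa 1.
Proof.
move=> r_gt0 rj; rewrite -[RHS]juxt11 -(@juxt1_absorb r 1) //.
by apply: kappa_juxt => //; rewrite -(juxtE _ rj) muln1 addnC.
Qed.

(** A common multiplier t brings both m and m.+1 into the interval above a power of
    q to which [juxt1_leading1] applies. *)
Lemma juxt1_succ m : q + q <= m ->
  kappa (juxt 1 m) = kappa (juxt 1 m.+1).
Proof.
move=> le_qm; set j := m + 2; set t := (q ^ j.+1 %/ m).+1.
have m_gt0 : 0 < m by lia.
apply: (@juxt1_cancel t) => //.
have Dq := divn_eq (q ^ j.+1) m; have lt_m := ltn_pmod (q ^ j.+1) m_gt0.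
have big : m.+1 + m.+1 < q ^ j.
  rewrite /j addn2 !expnS; apply: leq_trans (_ : 2 * (2 * q ^ m) <= _).
    by have := juxt_room m; lia.
  by rewrite !leq_mul.
(* t * m exceeds q ^ j.+1 by at most m, and t - 1 is at most half of q ^ j. *)
have [r [r_gt0 Dr rj]] : exists r, [/\ 0 < r, t * m = q ^ j.+1 + r & r + t < q ^ j].
  have DQ := expnS q j; move: Dq lt_m DQ big; rewrite /t.
  move: (q ^ j.+1) (q ^ j) (_ %/ m) (_ %% m) => Q Q' a b -> lt_bm DQ big.
  have le_a : a + a <= Q'.
    rewrite -(@leq_pmul2l q) // -DQ; apply: leq_trans (leq_addr b _).
    by rewrite mulnDr -mulnDl mulnC leq_mul2l le_qm orbT.
  by exists (m - b); split; lia.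
rewrite mulnS addnC Dr -addnA !juxt1_leading1 //; nia.
Qed.

(** Large integers are reached from one just above a power of q by steps of 1;
    any other n is equivalent to a large multiple q ^ (e * k) * n. *)
Lemma juxt1_const n : 0 < n -> kappa (juxt 1 n) = kappa 1.
Proof.
have large m : q + q <= m -> kappa (juxt 1 m) = kappa 1.
  move=> le_qm; rewrite -(@juxt1_leading1 m.+1 1) //; last first.
    by have := juxt_room m.+1; lia.
  have : m <= q ^ m.+2 + 1 by have := juxt_room m.+2; lia.
  elim: (_ + 1) => [|M IH]; first by case: m le_qm => //; lia.
  rewrite leq_eqVlt => /predU1P[-> //|lt_mM].
  by rewrite IH // juxt1_succ //; lia.
move=> n_gt0; have [e e_gt0 en] := kappa_torsion q_gt0.
rewrite -(large (q ^ (e * (q + q)) * n)); last first.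
  rewrite -[leqLHS]muln1; apply: leq_mul => //.
  by apply: ltnW; apply: leq_ltn_trans (ltn_expl _ q_gt1); rewrite leq_pmull.
apply: kappa_juxt => //; rewrite -[in LHS](mul1n n).
apply: kappaM => //; rewrite expnM.
elim: (q + q) => [|k IH] //=; rewrite expnS -[in LHS](mul1n 1); exact: kappaM.
Qed.

End Congruence.

(** * Completely multiplicative automatic sequences *)

(** A function factoring through a finite set has the same fibres as a map to a
    finite type; this makes a finite range available as a [finType]. *)
Lemma finite_quotient (T : Type) (S : finType) (sigma : nat -> S) (F : nat -> T) :
  (forall r r', sigma r = sigma r' -> F r = F r') ->
  exists kappa : nat -> option S, forall r r', kappa r = kappa r' <-> F r = F r'.
Proof.
move=> sigmaF.
exists (fun r => [pick s | `[< exists2 x, sigma x = s & F x = F r >]]) => r r'.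
split=> [|->] //.
case: pickP => [s /asboolP[x <- <-]|/(_ (sigma r)) /asboolP[]]; last by exists r.
case: pickP => // s' /asboolP[y <- <-] [exy]; exact: sigmaF.
Qed.

(** Equivalence of r and r' means that L (q ^ j.+1 * n + r) and
    L (q ^ j'.+1 * n + r') agree for all n; taking multiples t * n and dividing by
    L t gives cancellation, taking n of the form q ^ i * n + m gives stability
    under prepending digits, and n = 0 shows that L factors through kappa. *)
Theorem automatic_multiplicative (R : idomainType) p (L : nat -> R) :
  1 < p -> automatic p L -> L 0 = 0%R -> L 1 = 1%R ->
  (forall m n, L (m * n)%N = (L m * L n)%R) ->
  (forall n, 0 < n -> L n != 0%R) ->
  exists k, forall n, L (1 + p ^ k * n) = 1%R.
Proof.
move=> p_gt1 /(automatic_tails p_gt1)[d [S [sigma]]]; set q := p ^ d.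
move=> [d_gt0 stab sigmaE] L0 L1 LM Lneq0.
have q_gt1 : 1 < q by rewrite -(exp1n d) ltn_exp2r.
have [|kappa kappaE] :=
    @finite_quotient _ _ sigma (fun r n => L (q ^ r.+1 * n + r)).
  by move=> r r' /sigmaE e; apply/funext.
have tailE r j n : r < q ^ j -> L (q ^ r.+1 * n + r) = L (q ^ j.+1 * n + r).
  by move=> rj; apply: stab => //; apply: ltn_expl.
have kappa_tail r r' j j' n : kappa r = kappa r' -> r < q ^ j -> r' < q ^ j' ->
    L (q ^ j.+1 * n + r) = L (q ^ j'.+1 * n + r').
  by move=> /kappaE/(congr1 (@^~ n)) e rj rj'; rewrite -!tailE.
have kappaI r r' j j' : r < q ^ j -> r' < q ^ j' ->
    (forall n, L (q ^ j.+1 * n + r) = L (q ^ j'.+1 * n + r')) -> kappa r = kappa r'.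
  by move=> rj rj' e; apply/kappaE/funext => n; rewrite !(tailE r j, tailE r' j').
have kappaL r r' : kappa r = kappa r' -> L r = L r'.
  by move=> /kappaE/(congr1 (@^~ 0)); rewrite !muln0.
have one : forall n, 0 < n -> kappa (juxt q 1 n) = kappa 1.
  move=> n; apply: (@juxt1_const q (option S) kappa) => //.
  - move=> r /kappaL; rewrite L0; case: (posnP r) => // /Lneq0 /eqP; by [].
  - move=> t r r' t_gt0 e.
    have lt_exp s : s < q ^ (t * s).
      by apply: leq_trans (ltn_expl _ q_gt1) _; rewrite leq_exp2l // leq_pmull.
    apply: (@kappaI r r' (t * r) (t * r')) => // k.
    apply: (mulfI (Lneq0 t t_gt0)); rewrite -!LM !mulnDr ![t * (_ * k)]mulnCA.
    by apply: kappa_tail => //; apply: ltn_expl.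
  move=> r r' j j' m e rj rj'.
  have room s i : s < q ^ i -> s + q ^ i.+1 * m < q ^ (i + m.+1).
    move=> si; rewrite expnD !expnS [q * q ^ i]mulnC -mulnA.
    apply: leq_trans (_ : q ^ i * (q * m.+1) <= _); last first.
      by rewrite !leq_mul // ltn_expl.
    rewrite mulnS mulnDr ltn_add2r.
    by rewrite (leq_trans si) // leq_pmulr // ltnW.
  apply: (kappaI _ _ (j + m.+1) (j' + m.+1)); rewrite ?room // => k.
  have split_digits s i : q ^ (i + m.+1).+1 * k + (s + q ^ i.+1 * m)
      = q ^ i.+1 * (q ^ m.+1 * k + m) + s.
    by rewrite -addSn expnD mulnDr mulnA addnCA addnC.
  by rewrite !split_digits; apply: kappa_tail.
exists (d * 2) => n; rewrite -L1; have [->|n_gt0] := posnP n.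
  by rewrite muln0.
apply: kappaL; rewrite expnM; exact: one.
Qed.

Lemma expn_cube_one_mod k x : x = 1 %[mod 3] -> x ^ (3 ^ k) = 1 %[mod 3 ^ k.+1].
Proof.
move=> x1; elim: k => [|k IH]; first by rewrite !expn1.
rewrite [3 ^ k.+1 in LHS]expnSr expnM; move: (x ^ _) IH => y.
rewrite [1 %% _]modn_small => [ymod|]; last by rewrite -(exp1n k.+1) ltn_exp2r.
rewrite (divn_eq y (3 ^ k.+1)) ymod; move: (y %/ _) => a.
rewrite [3 ^ k.+2]expnS; set N := 3 ^ k.+1.
have [M NE] : exists M, N = 3 * M by exists (3 ^ k); rewrite -expnS.
rewrite (_ : _ ^ 3 = (a + N * a ^ 2 + M * N * a ^ 3) * (3 * N) + 1) ?modnMDl //.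
by rewrite NE; ring.
Qed.

Local Open Scope ring_scope.

(** * Power series and reduction modulo a prime *)

Section FpsMap.
Variables (R S : comNzRingType) (phi : {rmorphism R -> S}).
Definition fps_map (f : fps R) : fps S := Fps (fun n => phi (fps_coef f n)).
Fact fps_map_is_zmod_morphism : zmod_morphism fps_map.
Proof. by move=> f g; apply/fpsP => n /=; rewrite rmorphB. Qed.
Fact fps_map_is_monoid_morphism : monoid_morphism fps_map.
Proof.
split=> [|f g]; apply/fpsP => n /=; first by rewrite rmorph_nat.
by rewrite rmorph_sum; apply: eq_bigr => i _; rewrite rmorphM.
Qed.
HB.instance Definition _ := GRing.isZmodMorphism.Build (fps R) (fps S)
  fps_map fps_map_is_zmod_morphism.
HB.instance Definition _ := GRing.isMonoidMorphism.Build (fps R) (fps S)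
  fps_map fps_map_is_monoid_morphism.

Lemma fps_map_of_poly p : fps_map (fps_of_poly p) = fps_of_poly (map_poly phi p).
Proof. by apply/fpsP => n /=; rewrite coef_map. Qed.

Lemma fps_map_root (P : {poly {poly R}}) f :
  (map_poly (@fps_of_poly R) P).[f] = 0 ->
  (map_poly (@fps_of_poly S) (map_poly (map_poly phi) P)).[fps_map f] = 0.
Proof.
move=> Pf; rewrite -[RHS](rmorph0 fps_map) -Pf -horner_map -!map_poly_comp.
by congr (_).[_]; apply: eq_map_poly => p /=; rewrite fps_map_of_poly.
Qed.
End FpsMap.

(** While p divides every coefficient, divide by p: series over the integers have
    no torsion, and a chosen nonzero coefficient decreases in absolute value. *)
Lemma primitive_annihilator (p : nat) (f : fps int) (P : {poly {poly int}}) :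
  (1 < p)%N -> P != 0 -> (map_poly (@fps_of_poly int) P).[f] = 0 ->
  exists2 Q : {poly {poly int}}, (exists i j, ~~ (p %| Q`_i`_j)%Z) &
    (map_poly (@fps_of_poly int) Q).[f] = 0.
Proof.
move=> p_gt1 P_neq0 Pf.
have [i [j Pij]] : exists i j, P`_i`_j != 0.
  exists (size P).-1, (size (lead_coef P)).-1.
  by have : lead_coef (lead_coef P) != 0 by rewrite !lead_coef_eq0.
have [N] := ubnP (absz (P`_i`_j)).
elim: N P {P_neq0} Pf Pij => // N IH P Pf Pij ltN.
have [[k [l kl]]|div] := pselect (exists i j, ~~ (p %| P`_i`_j)%Z).
  by exists P => //; exists k, l.
have {}div k l : (p %| P`_k`_l)%Z by apply: contra_notT div => kl; exists k, l.
pose Q : {poly {poly int}} := \poly_(k < size P) \poly_(l < size P`_k) (P`_k`_l %/ p)%Z.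
have QE k l : Q`_k`_l = (P`_k`_l %/ p)%Z.
  rewrite !coef_poly; have [lt|le] := ltnP k; last first.
    by rewrite [P`_k]nth_default // !coef0 div0z.
  by rewrite coef_poly; have [//|le'] := ltnP l; rewrite [_`_l]nth_default ?div0z.
have PE : P = (p%:Z%:P)%:P * Q.
  by apply/polyP => k; apply/polyP => l; rewrite !coefCM QE mulrC divzK.
apply: (IH Q).
- apply/fpsP => n; move: Pf => /fpsP/(_ n).
  rewrite PE rmorphM hornerM /= map_polyC hornerC /=.
  set g := _.[f]; rewrite big_ord_recl big1 ?addr0 => [|l _]; last by rewrite coefC /= mul0r.
  rewrite coefC /= subn0 => /eqP; rewrite mulf_eq0 => /orP[/eqP|/eqP //].
  by move: p_gt1; lia.
- by rewrite QE; have := divzK (div i j); move: Pij; move: (P`_i`_j) (_ %/ _)%Z => x y; nia.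
- rewrite -ltnS; apply: leq_trans ltN; rewrite ltnS QE.
  have := divzK (div i j); move: Pij; move: (P`_i`_j) (_ %/ _)%Z => x y; nia.
Qed.

Section Series.
Variable R : comNzRingType.
Local Notation iota := (@fps_of_poly R).
Implicit Types f g h : fps R.

Lemma fps_coefD f g n : fps_coef (f + g) n = fps_coef f n + fps_coef g n.
Proof. by []. Qed.

Definition fpsX : fps R := iota 'X.
Definition shift f : fps R := Fps (fun n => fps_coef f n.+1).

Lemma fps_coef0M f g : fps_coef (f * g) 0 = fps_coef f 0 * fps_coef g 0.
Proof. by rewrite /= big_ord1. Qed.

Lemma fps_coefCM a f n : fps_coef (iota a%:P * f) n = a * fps_coef f n.
Proof.
rewrite /= big_ord_recl big1 => [|i _]; last by rewrite coefC mul0r.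
by rewrite coefC addr0 subn0.
Qed.

Lemma fps_coefXnM k f n :
  fps_coef (fpsX ^+ k * f) n = if (n < k)%N then 0 else fps_coef f (n - k).
Proof.
elim: k n f => [|k IH] n f; first by rewrite mul1r subn0.
rewrite exprSr -mulrA IH; case: (ltngtP n k) => [lt|gt|->].
- by rewrite ltnW.
- rewrite ltnS leqNgt gt /=; move: (ltnW gt) => ge.
  have : (0 < n - k)%N by rewrite subn_gt0.
  rewrite subnS; case: (n - k)%N => // m _.
  rewrite /= !big_ord_recl big1 => [|i _]; last by rewrite coefX mul0r.
  by rewrite !coefX mul0r mul1r add0r addr0 subSS subn0.
by rewrite ltnS leqnn subnn fps_coef0M /= coefX mul0r.
Qed.

Lemma fps_shift f : f = iota (fps_coef f 0)%:P + fpsX ^+ 1 * shift f.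
Proof.
apply/fpsP => n; rewrite fps_coefD fps_coefXnM [fps_coef (iota _) n]coefC.
by case: n => [|n]; rewrite ?addr0 ?add0r // subn1.
Qed.

End Series.

(** If v is the order of f, the coefficient of index v + n of f * g is that of f at
    v times that of g at n, once the earlier coefficients of g vanish. *)
Lemma fps_integral (R : idomainType) (f g : fps R) : f != 0 -> f * g = 0 -> g = 0.
Proof.
move=> f0 fg0.
have ex : exists v, fps_coef f v != 0.
  apply: contrapT => nf; case/eqP: f0; apply/fpsP => n.
  by apply/eqP; apply: contra_notT nf => fn; exists n.
case: (ex_minnP ex) => v fv vmin; apply/fpsP => n.
have [N] := ubnP n; elim: N n => // N IH n; rewrite ltnS => le_nN.
have := congr1 (fun h => fps_coef h (v + n)%N) fg0.
have lt_v : (v < (v + n).+1)%N by rewrite ltnS leq_addr.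
rewrite /= (bigD1 (Ordinal lt_v)) //= addKn big1 ?addr0.
  by move=> /eqP; rewrite mulf_eq0 (negPf fv) => /eqP.
move=> i /eqP neq_iv; have [lt_iv|le_vi] := ltnP i v.
  have [-> | /vmin] := eqVneq (fps_coef f i) 0; first by rewrite mul0r.
  by rewrite leqNgt lt_iv.
rewrite IH ?mulr0 //; apply: leq_trans le_nN.
have : (i : nat) <> v by move=> e; apply: neq_iv; apply: val_inj.
by have := ltn_ord i; lia.
Qed.

(** * Cartier operators and additive relations *)

Section Cartier.
Variables (p : nat) (F : finFieldType).
Hypotheses (p_pr : prime p) (cardF : #|F| = p).
Local Notation iota := (@fps_of_poly F).
Implicit Types (f g h : fps F) (c : {poly F}).

Definition cartier r f : fps F := Fps (fun n => fps_coef f (p * n + r)).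
Definition poly_cartier r c : {poly F} := \poly_(n < size c) c`_(p * n + r).

Lemma poly_cartierE r c n : (poly_cartier r c)`_n = c`_(p * n + r).
Proof.
rewrite coef_poly; have [//|le] := ltnP; rewrite nth_default //.
by apply: leq_trans le _; have := prime_gt0 p_pr; nia.
Qed.

Lemma cartierE r f n : fps_coef (cartier r f) n = fps_coef f (p * n + r).
Proof. by []. Qed.

Lemma cartier_of_poly r c : cartier r (iota c) = iota (poly_cartier r c).
Proof. by apply/fpsP => n /=; rewrite poly_cartierE. Qed.

Lemma cartier_eq0 f : (forall r, (r < p)%N -> cartier r f = 0) -> f = 0.
Proof.
move=> f0; apply/fpsP => n.
have /f0/fpsP/(_ (n %/ p)%N) : (n %% p < p)%N by rewrite ltn_mod prime_gt0.
by rewrite /= mulnC -divn_eq.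
Qed.

Fact cartier_is_zmod_morphism r : zmod_morphism (cartier r).
Proof. by move=> f g; apply/fpsP. Qed.
HB.instance Definition _ r := GRing.isZmodMorphism.Build (fps F) (fps F)
  (cartier r) (cartier_is_zmod_morphism r).

Lemma pchar_fps : p \in [pchar (fps F)].
Proof.
rewrite inE p_pr /=; apply/eqP; apply/fpsP => n.
have E k : fps_coef (k%:R : fps F) n = (n == 0%N)%:R *+ k.
  elim: k => // k IH; rewrite !mulrS.
  by rewrite fps_coefD IH.
have /pcharf0 p0 : p \in [pchar F] by apply: (@card_finPcharP _ p 1) p_pr; rewrite expn1.
by rewrite E -mulr_natr p0 mulr0.
Qed.

(** The Cartier operators are linear over p-th powers.  Rather than computing
    f ^+ p as f(z ^ p), expand f as its constant term plus z times its shift: the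
    Frobenius map respects this and the claim follows coefficient by
    coefficient. *)
Lemma cartier_pow r f h : (r < p)%N -> cartier r (f ^+ p * h) = f * cartier r h.
Proof.
(* Fermat: the constant term is its own p-th power. *)
have frob g : g ^+ p = iota (fps_coef g 0)%:P + fpsX F ^+ p * shift g ^+ p.
  rewrite {1}[g]fps_shift exprDn_pchar; last by rewrite pnatE ?pchar_fps.
  by rewrite exprMn -rmorphXn -polyC_exp -{1}cardF expf_card.
move=> lt_rp; apply/fpsP => n; elim: n f h => [|n IH] f h.
  rewrite fps_coef0M !cartierE frob mulrDl -mulrA fps_coefD.
  by rewrite fps_coefCM fps_coefXnM muln0 add0n lt_rp addr0.
rewrite {2}[f]fps_shift cartierE frob !mulrDl -!mulrA.
rewrite !fps_coefD !fps_coefCM !fps_coefXnM mulnS -addnA ltnNge leq_addr addKn.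
by rewrite subSS subn0 -IH !cartierE mulnS addnA.
Qed.

Lemma cartier_term r c i f : (r < p)%N ->
  cartier r (iota c * f ^+ (p ^ i.+1)) = iota (poly_cartier r c) * f ^+ (p ^ i).
Proof.
by move=> rp; rewrite mulrC expnSr exprM cartier_pow // cartier_of_poly mulrC.
Qed.

(** Pseudo-division of the m + 1 powers Y ^ (p ^ i) by P leaves remainders in
    a space of dimension m = deg P, so they are linearly dependent.  The matrix of
    remainders is made square by a zero last column, so that the dependency
    comes from the vanishing of its determinant. *)
Lemma ore_relation f (P : {poly {poly F}}) :
  P != 0 -> (map_poly iota P).[f] = 0 ->
  exists m (c : nat -> {poly F}), (exists2 i, (i <= m)%N & c i != 0) /\
    \sum_(i < m.+1) iota (c i) * f ^+ (p ^ i) = 0.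
Proof.
move=> P0 Pf; set m := (size P).-1.
pose rem i := Pdiv.Idomain.modp 'X^(p ^ i) P.
pose M : 'M[{poly F}]_m.+1 := \matrix_(i, l) (rem i)`_l.
have remE i : (map_poly iota (rem i)).[f]
    = iota (lead_coef P) ^+ scalp 'X^(p ^ i) P * f ^+ (p ^ i).
  have /(congr1 (fun Q => (map_poly iota Q).[f])) := Pdiv.Idomain.divp_eq 'X^(p ^ i) P.
  rewrite rmorphD rmorphM /= hornerD hornerM Pf mulr0 add0r => <-.
  by rewrite map_polyZ /= hornerZ rmorphXn /= map_polyXn hornerXn.
have szM i : (size (rem i) <= m)%N.
  by rewrite -ltnS prednK ?size_poly_gt0 // ltn_modp.
have /eqP/det0P[v v0 vM] : \det M = 0.
  rewrite (expand_det_col _ ord_max) big1 // => i _.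
  by rewrite !mxE nth_default ?mul0r.
pose c i := v 0 (inord i) * lead_coef P ^+ scalp 'X^(p ^ i) P.
exists m, c; split.
  have /rV0Pn[i vi] := v0.
  exists i; first by rewrite -ltnS.
  by rewrite /c inord_val mulf_neq0 // expf_neq0 // lead_coef_eq0.
have vrem : \sum_(i < m.+1) (v 0 i)%:P * rem i = 0.
  apply/polyP => l; rewrite coef_sum coef0.
  have [lt_lm|le_ml] := ltnP l m.+1.
    have /rowP/(_ (Ordinal lt_lm)) := vM; rewrite !mxE => vMl; rewrite -[RHS]vMl.
    by apply: eq_bigr => i _; rewrite coefCM mxE.
  rewrite big1 // => i _; rewrite coefCM nth_default ?mulr0 //.
  by apply: leq_trans (szM i) _; apply: ltnW.
have /(congr1 (fun Q => (map_poly iota Q).[f])) := vrem.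
rewrite rmorph0 horner0 rmorph_sum horner_sum => vf; rewrite -[RHS]vf.
apply: eq_bigr => i _.
rewrite [in RHS]rmorphM hornerM /= map_polyC hornerC /= remE.
by rewrite /c inord_val rmorphM rmorphXn mulrA.
Qed.

(** If c 0 = 0 all terms are p-th powers up to their coefficients, and a Cartier
    operator that does not kill them all produces a shorter relation. *)
Lemma ore_relation_separable f (P : {poly {poly F}}) :
  P != 0 -> (map_poly iota P).[f] = 0 ->
  exists m (c : nat -> {poly F}), c 0%N != 0 /\
    \sum_(i < m.+1) iota (c i) * f ^+ (p ^ i) = 0.
Proof.
move=> P0 /(ore_relation P0) [m [c [[k le_km ck] cf]]].
elim: m c k le_km ck cf => [|m IH] c k le_km ck cf.
  by exists 0%N, c; move: le_km ck; rewrite leqn0 => /eqP->.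
have [c0|c0] := eqVneq (c 0%N) 0; last by exists m.+1, c.
case: k => [|k] in le_km ck *; first by rewrite c0 eqxx in ck.
have [r rp ckr] : exists2 r, (r < p)%N & poly_cartier r (c k.+1) != 0.
  apply: contrapT => nr; case/eqP: ck; apply: fps_of_poly_inj.
  rewrite rmorph0; apply: cartier_eq0 => r rp; rewrite cartier_of_poly.
  have [->|nz] := eqVneq (poly_cartier r (c k.+1)) 0; first by rewrite rmorph0.
  by case: nr; exists r.
apply: (IH (fun i => poly_cartier r (c i.+1)) k) => //.
have := congr1 (cartier r) cf.
rewrite raddf0 big_ord_recl c0 rmorph0 mul0r add0r raddf_sum => cf'.
by rewrite -[RHS]cf'; apply: eq_bigr => i _; rewrite -cartier_term.
Qed.

End Cartier.

(** * The kernel of an algebraic series *)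

Section Kernel.
Variables (p : nat) (F : finFieldType).
Hypotheses (p_pr : prime p) (cardF : #|F| = p).
Local Notation iota := (@fps_of_poly F).
Variables (f : fps F) (m : nat) (c : nat -> {poly F}).
Hypothesis c0 : c 0%N != 0.
Hypothesis ore : \sum_(i < m.+2) iota (c i) * f ^+ (p ^ i) = 0.

Let D := iota (c 0%N).
Let E := (p ^ m.+1)%N.
Definition ore_term i := D ^+ (E - p ^ i) * f ^+ (p ^ i).
(** Formally h is the sum of the b_i g ^ (p ^ i) where g = f / c_0; multiplying by
    c_0 ^ E keeps everything inside power series. *)
Definition represents (b : nat -> {poly F}) (h : fps F) :=
  D ^+ E * h = \sum_(i < m.+2) iota (b i) * ore_term i.

(** The relation, in the form g = - sum of c_i c_0 ^ (p ^ i - 2) g ^ (p ^ i) over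
    i > 0, eliminates the term in g; only p-th powers remain, to which Cartier
    operators apply. *)
Definition reduct (b : nat -> {poly F}) i :=
  b i.+1 - b 0%N * (c i.+1 * c 0%N ^+ (p ^ i.+1 - 2)).
Definition cartier_code r (b : nat -> {poly F}) i :=
  if (i < m.+1)%N then poly_cartier p r (reduct b i) else 0.

Let p_gt1 : (1 < p)%N := prime_gt1 p_pr.
Let p_gt0 : (0 < p)%N := prime_gt0 p_pr.

Let D0 : D != 0.
Proof.
by apply: contra_neq c0 => D0; apply: fps_of_poly_inj; rewrite -/D D0 rmorph0.
Qed.

Lemma represents_inj b h h' : represents b h -> represents b h' -> h = h'.
Proof.
rewrite /represents => <- /eqP; rewrite eq_sym -subr_eq0 -mulrBr => /eqP e.
apply/eqP; rewrite -subr_eq0; apply/eqP; elim: E e => [|k IH]; first by rewrite mul1r.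
by rewrite exprS -mulrA => /(fps_integral D0).
Qed.

Lemma le_pow i j : (i <= j)%N -> (p ^ i <= p ^ j)%N.
Proof. by move=> le_ij; rewrite leq_pexp2l. Qed.

Lemma reductE b h : represents b h ->
  D ^+ E * h = \sum_(i < m.+1) iota (reduct b i) * ore_term i.+1.
Proof.
rewrite /represents => ->; rewrite big_ord_recl /= {1}/ore_term expn0 expr1.
have Eg : (2 <= E)%N by rewrite /E; apply: leq_trans p_gt1 _; rewrite -{1}(expn1 p) le_pow.
have -> : D ^+ (E - 1) * f
    = - \sum_(i < m.+1) iota (c i.+1 * c 0%N ^+ (p ^ i.+1 - 2)) * ore_term i.+1.
  have -> : (E - 1 = (E - 2) + 1)%N by lia.
  move/eqP: ore; rewrite big_ord_recl expn0 expr1 addr_eq0 => /eqP Df.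
  rewrite exprD expr1 -mulrA Df mulrN; congr (- _).
  rewrite mulr_sumr; apply: eq_bigr => i _; rewrite /ore_term rmorphM rmorphXn /= -/D.
  have -> : (E - 2 = (p ^ i.+1 - 2) + (E - p ^ i.+1))%N.
    have : (2 <= p ^ i.+1)%N by apply: leq_trans p_gt1 _; rewrite -{1}(expn1 p) le_pow.
    have : (p ^ i.+1 <= E)%N by rewrite le_pow //.
    lia.
  rewrite exprD -[bump 0 i]/i.+1; ring.
rewrite mulrN mulr_sumr -sumrN -big_split; apply: eq_bigr => i _ /=.
rewrite -[bump 0 i]/i.+1 /reduct rmorphB rmorphM; ring.
Qed.

Lemma represents_cartier_code r b h : (r < p)%N ->
  represents b h -> represents (cartier_code r b) (cartier p r h).
Proof.
move=> rp /reductE/(congr1 (cartier p r)).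
rewrite raddf_sum {1}/E expnSr exprM cartier_pow // => e.
rewrite /represents.
have -> : D ^+ E * cartier p r h = D ^+ (E - p ^ m) * (D ^+ (p ^ m) * cartier p r h).
  by rewrite mulrA -exprD subnK // le_pow.
rewrite e [RHS]big_ord_recr /= /cartier_code ltnn rmorph0 mul0r addr0 mulr_sumr.
apply: eq_bigr => i _; rewrite ltn_ord.
have le_i : (p ^ i <= p ^ m)%N by rewrite le_pow // -ltnS.
have -> : iota (reduct b i) * ore_term i.+1
    = (D ^+ (p ^ m - p ^ i) * f ^+ (p ^ i)) ^+ p * iota (reduct b i).
  rewrite /ore_term /E !expnSr -mulnBl [RHS]mulrC exprMn -!exprM; ring.
rewrite cartier_pow // cartier_of_poly // /ore_term.
have -> : (E - p ^ i = (E - p ^ m) + (p ^ m - p ^ i))%N.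
  by have : (p ^ m <= E)%N by [rewrite le_pow]; lia.
rewrite exprD; ring.
Qed.

(** Reduction adds at most this bound to the size of a coefficient and a Cartier
    operator divides the size by p >= 2, so the bound is preserved. *)
Definition degree_bound := (size (c 0%N) +
  \sum_(i < m.+1) size (c i.+1 * c 0%N ^+ (p ^ i.+1 - 2))%R)%N.

Lemma size_cartier_code r (b : nat -> {poly F}) : (forall i, (size (b i) <= degree_bound)%N) ->
  forall i, (size (cartier_code r b i) <= degree_bound)%N.
Proof.
move=> szb i; rewrite /cartier_code; case: ltnP => [lt_im|_]; last by rewrite size_poly0.
have sz : (size (reduct b i) <= p * degree_bound)%N.
  apply: leq_trans (_ : degree_bound + degree_bound <= _)%N; last first.
    by rewrite addnn -mul2n leq_mul2r p_gt1 orbT.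
  apply: leq_trans (size_polyD _ _) _; rewrite size_polyN geq_max.
  rewrite (leq_trans (szb _) (leq_addr _ _)) /=.
  apply: leq_trans (size_polyMleq _ _) _; apply: leq_trans (leq_pred _) _.
  apply: leq_add (szb _) _; apply: leq_trans (leq_addl _ _).
  by rewrite (bigD1 (Ordinal lt_im)) //= leq_addr.
apply/leq_sizeP => n le_n; rewrite poly_cartierE //.
by move/leq_sizeP: sz; apply; nia.
Qed.

Lemma represents_self : represents (fun i => if i is 0 then c 0%N else 0) f.
Proof.
rewrite /represents big_ord_recl big1 ?addr0 => [|i _]; last by rewrite rmorph0 mul0r.
by rewrite /ore_term expn0 expr1 mulrA -exprS subn1 prednK // expn_gt0 p_gt0.
Qed.

(** The codes b of bounded degree form a finite type; a code that represents no
    series is sent to the zero series, so that the kernel is closed. *)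
Lemma kernel_automatic : automatic p (fps_coef f).
Proof.
pose S : finType := {ffun 'I_m.+2 -> 'rV[F]_degree_bound}.
pose dec (s : S) i : {poly F} := rVpoly (s (inord i)).
pose enc (b : nat -> {poly F}) : S := [ffun i : 'I_m.+2 => poly_rV (b i)].
have represents_enc (b : nat -> {poly F}) h : (forall i, (size (b i) <= degree_bound)%N) ->
    represents b h -> represents (dec (enc b)) h.
  move=> szb; rewrite /represents => ->; apply: eq_bigr => i _.
  by rewrite /dec /enc ffunE inord_val poly_rV_K.
have [val valP] : {val : S -> fps F | forall s,
    represents (dec s) (val s) \/
    (forall h, ~ represents (dec s) h) /\ val s = 0}.
  apply: cid.
  have /choice[v vP] : forall s, exists g, represents (dec s) g \/
      (forall h, ~ represents (dec s) h) /\ g = 0.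
    move=> s; have [[g sg]|no] := pselect (exists g, represents (dec s) g).
      by exists g; left.
    by exists 0; right; split=> // h sh; apply: no; exists h.
  by exists v.
have valE s h : represents (dec s) h -> val s = h.
  by move=> sh; have [/represents_inj/(_ sh)|[/(_ h)]] := valP s.
exists S, (fun s => fps_coef (val s)); split.
  exists (enc (fun i => if i is 0 then c 0%N else 0)).
  move=> n; rewrite (@valE _ f) //; apply: represents_enc represents_self.
  by case=> [|i]; rewrite ?size_poly0 // leq_addr.
move=> s r rp; have [sh|[_ s0]] := valP s; last by exists s => n; rewrite s0.
exists (enc (cartier_code r (dec s))) => n; rewrite (@valE _ (cartier p r (val s))) //.
apply: represents_enc; last exact: represents_cartier_code.
by apply: size_cartier_code => i; apply: size_poly.
Qed.
End Kernel.

(** The relation is padded with one zero coefficient: for m = 0 it would not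
    contain a p-th power, and c_0 ^ (E - 2) would not make sense. *)
Theorem algebraic_automatic (p : nat) (F : finFieldType) (f : fps F)
    (P : {poly {poly F}}) :
  prime p -> #|F| = p -> P != 0 -> (map_poly (@fps_of_poly F) P).[f] = 0 ->
  automatic p (fps_coef f).
Proof.
move=> p_pr cardF P0 /(ore_relation_separable p_pr cardF P0) [m [c [c0 ore]]].
apply: (@kernel_automatic p F p_pr cardF f m (fun i => if (i < m.+1)%N then c i else 0)) => //.
rewrite big_ord_recr /= ltnn rmorph0 mul0r addr0 -[RHS]ore.
by apply: eq_bigr => i _; rewrite ltn_ord.
Qed.

(** * Transcendence *)

Theorem corollary1 (lambda : nat -> int) (hlambda : is_liouville lambda) :
  fps_transcendental (fps_from1 lambda).
Proof.
have [lambdaU lambda1 lambdaM lambda_prime] := hlambda.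
move=> [P P0 /(primitive_annihilator (isT : (1 < 3)%N) P0)[Q [i [j Qij]] Qf]].
pose red : {rmorphism int -> 'F_3} := intmul 1.
have red0 z : (red z == 0) = (3 %| z)%Z.
  by rewrite (@dvdz_pcharf 'F_3 3) ?pchar_Fp.
have Q0 : map_poly (map_poly red) Q != 0.
  apply: contraNneq Qij => /(congr1 (fun R : {poly {poly 'F_3}} => R`_i`_j)).
  by rewrite !coef_map /= !coef0 => /eqP; rewrite red0.
have card3 : #|'F_3| = 3%N by rewrite card_Fp.
have aut := algebraic_automatic (isT : prime 3) card3 Q0 (fps_map_root red Qf).
set L := fps_coef _ in aut.
have LE n : (0 < n)%N -> L n = red (lambda n) by rewrite /L /= => ->.
have L0 : L 0%N = 0 by rewrite /L /= rmorph0.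
have L1 : L 1%N = 1 by rewrite LE // lambda1 rmorph1.
have LM a b : L (a * b)%N = L a * L b.
  have [->|a0] := posnP a; first by rewrite L0 mul0r.
  have [->|b0] := posnP b; first by rewrite muln0 L0 mulr0.
  by rewrite !LE ?muln_gt0 ?a0 // lambdaM // rmorphM.
have Lneq0 n : (0 < n)%N -> L n != 0.
  by move=> n0; rewrite LE // red0; have [-> | ->] := lambdaU n n0.
have [k Lk] := automatic_multiplicative (isT : (1 < 3)%N) aut L0 L1 LM Lneq0.
(* All powers 7 ^ (3 ^ k) have odd exponents but are congruent to 1. *)
have L7 e : L (7 ^ e)%N = (-1) ^+ e.
  elim: e => [|e IH]; first by rewrite expn0 L1.
  by rewrite expnS LM IH exprS LE // lambda_prime // rmorphN1.
have pow7 : (7 ^ (3 ^ k) = 1 %[mod 3 ^ k])%N.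
  have := expn_cube_one_mod k (erefl : (7 = 1 %[mod 3])%N).
  move=> /(congr1 (modn^~ (3 ^ k)%N)).
  by rewrite !modn_dvdm // expnS dvdn_mull.
have [n Dn] : exists n, (7 ^ (3 ^ k) = 1 + 3 ^ k * n)%N.
  have : (3 ^ k %| 7 ^ (3 ^ k) - 1)%N by rewrite -eqn_mod_dvd ?expn_gt0 //; apply/eqP.
  move=> /dvdnP[n Dn]; exists n; rewrite mulnC -Dn subnKC // expn_gt0 //.
have := Lk n; rewrite -Dn L7 -signr_odd oddX orbT => /eqP.
by apply/negP.
Qed.
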